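(* Let $q$ be a prime power and let $C$ be a self-dual linear code over $\mathbb{F}_q$ of length $n=2d+4$ and minimum distance $d$ (so that its genus $g=n/2+1-d$ equals $3$), with Hamming weight enumerator \[ W(x,y)=x^{2d+4}+A_d x^{d+4} y^d+\sum_{i=d+1}^{2d+4}A_i x^{2d+4-i}y^i . \] Then $W(x,y)$ satisfies the Riemann hypothesis if and only if all the roots of the cubic polynomial \[ f_3 X^3+f_2 X^2+f_1 X+f_0 \] are contained in the interval $[-2\sqrt{q}, 2\sqrt{q}]$, where \begin{align*} f_3&= A_d, \\ f_2&=(q-d)A_d-\frac{d+1}{d+4}A_{d+1},\\ f_1&=\frac{1}{2}(d^2 -2q d+d-6q)A_d+(d-q+1)\frac{d+1}{d+4}A_{d+1}+\frac{(d+1)(d+2)}{(d+3)(d+4)}A_{d+2},\\ f_0&=\frac{1}{2}(q+1)(d^2+3 d-4q+2)A_d+(q+1)(d+1)(d+2)\frac{A_{d+1}}{d+4}\\ &\quad +(q+1)\frac{(d+1)(d+2)}{(d+3)(d+4)}A_{d+2}-(q-1)\binom{2d+4}{d+4}. \end{align*}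
   Context: For a linear $[n,k,d]$-code over $\mathbb{F}_q$ with Hamming weight enumerator $W(x,y)=x^n+\sum_{i=d}^n A_i x^{n-i}y^i$ ($A_d\neq 0$), the zeta polynomial is the unique polynomial $P(T)\in\mathbb{R}[T]$ of degree at most $n-d$ such that, in the formal power series expansion in $T$ of \[ \frac{P(T)}{(1-T)(1-qT)}\,(y(1-T)+xT)^n , \] the coefficient of $T^{n-d}$ equals $\dfrac{W(x,y)-x^n}{q-1}$. The zeta function is $Z(T)=P(T)/((1-T)(1-qT))$. The weight enumerator (or code) is said to satisfy the Riemann hypothesis if all the zeros of $P(T)$ have the same absolute value $1/\sqrt{q}$. A self-dual weight enumerator means the Hamming weight enumerator of a self-dual code. *)

(* Defs.v *)
From HB Require Import structures.
From mathcomp Require Import all_boot all_order all_algebra.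
From mathcomp Require Import mpoly complex reals.

Set Implicit Arguments.
Unset Strict Implicit.
Unset Printing Implicit Defensive.

Import Order.TTheory GRing.Theory Num.Theory.

Local Open Scope ring_scope.

Definition hdist (F : finFieldType) (n : nat) (u v : 'rV[F]_n) : nat :=
  #|[set i : 'I_n | u 0 i != v 0 i]|.

Definition hweight (F : finFieldType) (n : nat) (u : 'rV[F]_n) : nat :=
  hdist u 0.

Definition min_distance (F : finFieldType) (n : nat)
    (C : {vspace 'rV[F]_n}) (d : nat) : Prop :=
  (exists u v, [/\ u \in C, v \in C, u != v & hdist u v = d]) /\
  (forall u v, u \in C -> v \in C -> u != v -> (d <= hdist u v)%N).

(* The dual is taken for the standard (Euclidean) inner product. *)
Definition dual_code (F : finFieldType) (n : nat) (C : {vspace 'rV[F]_n}) :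
    {set 'rV[F]_n} :=
  [set u : 'rV[F]_n | [forall v : 'rV[F]_n,
              (v \in C) ==> (\sum_(i < n) u 0 i * v 0 i == 0)]].

Definition self_dual (F : finFieldType) (n : nat) (C : {vspace 'rV[F]_n}) :
    Prop :=
  C =i dual_code C.

Definition weight_count (F : finFieldType) (n : nat) (C : {vspace 'rV[F]_n})
    (i : nat) : nat :=
  #|[set c : 'rV[F]_n | (c \in C) && (hweight c == i)]|.

Definition xvar (R : realType) : {mpoly R[2]} := 'X_(@ord0 1).
Definition yvar (R : realType) : {mpoly R[2]} := 'X_(@ord_max 1).

Definition weight_enumerator (R : realType) (F : finFieldType) (n : nat)
    (C : {vspace 'rV[F]_n}) : {mpoly R[2]} :=
  \sum_(i < n.+1) (weight_count C i)%:R *: (xvar R ^+ (n - i) * yvar R ^+ i).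

(* Formal power series over [A] are represented by coefficient sequences. *)

Definition fps_mul (A : comNzRingType) (f g : nat -> A) : nat -> A :=
  fun m => \sum_(i < m.+1) f i * g (m - i)%N.

Definition fps_of_poly (A : comNzRingType) (p : {poly A}) : nat -> A :=
  fun m => p`_m.

Definition fps_geom (A : comNzRingType) (a : A) : nat -> A :=
  fun m => a ^+ m.

(* [fps_geom a] is the expansion of 1 / (1 - a T). *)
Lemma fps_geomP (A : comNzRingType) (a : A) (m : nat) :
  fps_mul (fps_of_poly (1 - a *: 'X)) (fps_geom a) m =
  fps_of_poly (1 : {poly A}) m.
Proof.
rewrite /fps_mul /fps_of_poly /fps_geom coef1.
case: m => [|m].
  by rewrite big_ord1 coefB coef1 coefZ coefX mulr0 subr0 mulr1.
rewrite big_ord_recl big_ord_recl big1 => [|i _] /=.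
  rewrite !coefB !coef1 !coefZ !coefX /= mulr0 subr0 mulr1 sub0r addr0.
  by rewrite /bump /= addn0 subn0 subn1 mul1r mulNr -exprS subrr.
by rewrite coefB coef1 coefZ coefX /bump /= mulr0 subr0 mul0r.
Qed.

(* Expansion in T of  P(T) / ((1 - T)(1 - qT)) * (y(1 - T) + xT)^n  with
   coefficients in R[x, y]; the polynomial variable ['X] is T. *)
Definition zeta_expansion (R : realType) (q n : nat) (P : {poly R}) :
    nat -> {mpoly R[2]} :=
  fps_mul
    (fps_mul (fps_of_poly (map_poly (@mpolyC 2 R) P))
             (fps_mul (fps_geom 1) (fps_geom q%:R)))
    (fps_of_poly (((yvar R)%:P * (1 - 'X) + (xvar R)%:P * 'X) ^+ n)).

Definition zeta_condition (R : realType) (q n d : nat) (W : {mpoly R[2]})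
    (P : {poly R}) : Prop :=
  (size P <= (n - d).+1)%N /\
  zeta_expansion q n P (n - d) = (q%:R - 1)^-1 *: (W - xvar R ^+ n).

Definition is_zeta_polynomial (R : realType) (q n d : nat) (W : {mpoly R[2]})
    (P : {poly R}) : Prop :=
  unique (zeta_condition q n d W) P.

Definition riemann_hypothesis (R : realType) (q n d : nat)
    (W : {mpoly R[2]}) : Prop :=
  exists P : {poly R}, is_zeta_polynomial q n d W P /\
    forall z : R[i], root (map_poly (real_complex R) P) z ->
      `|z| = ((Num.sqrt (q%:R : R))^-1)%:C%C.

Definition all_roots_in (R : realType) (p : {poly R}) (a b : R) : Prop :=
  forall z : R[i], root (map_poly (real_complex R) p) z ->
    exists x : R, z = x%:C%C /\ a <= x <= b.

Section Cubic.
Context (R : realType) (q d : nat) (A : nat -> nat).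
Let D : R := d%:R.
Let Q : R := q%:R.
Let A0 : R := (A d)%:R.
Let A1 : R := (A d.+1)%:R.
Let A2 : R := (A d.+2)%:R.

Definition f3 : R := A0.

Definition f2 : R := (Q - D) * A0 - (D + 1) / (D + 4) * A1.

Definition f1 : R :=
  1 / 2 * (D ^+ 2 - 2 * Q * D + D - 6 * Q) * A0
  + (D - Q + 1) * ((D + 1) / (D + 4)) * A1
  + ((D + 1) * (D + 2)) / ((D + 3) * (D + 4)) * A2.

Definition f0 : R :=
  1 / 2 * (Q + 1) * (D ^+ 2 + 3 * D - 4 * Q + 2) * A0
  + (Q + 1) * (D + 1) * (D + 2) * (A1 / (D + 4))
  + (Q + 1) * (((D + 1) * (D + 2)) / ((D + 3) * (D + 4))) * A2
  - (Q - 1) * 'C(2 * d + 4, d + 4)%:R.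

(* Up to a positive constant, P(T) / T^3 = - cubic (- (1 / T + q T)). *)
Definition cubic : {poly R} :=
  f3 *: 'X^3 + f2 *: 'X^2 + f1 *: 'X + f0%:P.
End Cubic.

(* Main.v *)
Require Import Defs.
From mathcomp Require Import all_boot all_order all_algebra.
From mathcomp Require Import mpoly complex reals.
From mathcomp Require Import finfield mxabelem.
From mathcomp Require Import ring lra zify.

(* In the basis y^(n-j) (x-y)^j, the coefficients of W are the binomial moments
   sum_i A_i C(n-i, j), i.e. the sums over the coordinate sets T of size j of the
   numbers of codewords vanishing on T.  Comparing coefficients, the coefficient
   of T^m in the zeta function is the mean of (#codewords - 1) / (q - 1) over the
   sets T with n - d - m elements.  For a self-dual code the codewords vanishing
   on T and those vanishing on its complement are related by linear algebra (this
   replaces the MacWilliams identity), so in genus 3 the zeta function is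
   determined by A_d, A_(d+1), A_(d+2), and P(T) is a palindromic sextic
   (for T -> 1/(qT)).  Then P(T)/T^3 is a cubic polynomial in 1/T + qT, and for
   T <> 0 one has |T| = 1/sqrt q iff 1/T + qT is real of absolute value at most
   2 sqrt q. *)

Local Open Scope ring_scope.
Import Order.TTheory GRing.Theory Num.Theory.

(** * Codewords vanishing on a coordinate set, and self-duality *)

Definition vanishing_on {F : finFieldType} {n : nat} (C : {vspace 'rV[F]_n})
    (T : {set 'I_n}) : {set 'rV[F]_n} :=
  [set c | (c \in C) && [forall i in T, c 0 i == 0]].

Section Code.
Context {F : finFieldType} {n : nat}.
Implicit Types (C : {vspace 'rV[F]_n}) (T : {set 'I_n}).

(** The rows are the unit vectors indexed by [T]: the row space consists of the vectors supported on
    [T], and multiplication by the transpose restricts a vector to [T]. *)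
Definition coord_mx T : 'M[F]_(#|T|, n) := rowsub enum_val 1%:M.

Lemma rank_coord_mx T : \rank (coord_mx T) = #|T|.
Proof.
apply/eqP; rewrite -[_ == _]/(row_free _); apply/row_freeP.
exists (coord_mx T)^T; rewrite mul_rowsub_mx mul1mx.
by apply/matrixP=> i j; rewrite !mxE (inj_eq enum_val_inj) eq_sym.
Qed.

Lemma mul_coord_tr_eq0 T (u : 'rV[F]_n) :
  (u *m (coord_mx T)^T == 0) = [forall i in T, u 0 i == 0].
Proof.
have uE j : (u *m (coord_mx T)^T) 0 j = u 0 (enum_val j).
  rewrite mxE (bigD1 (enum_val j)) //= big1 => [|i /negPf ij].
    by rewrite !mxE eqxx mulr1 addr0.
  by rewrite !mxE eq_sym ij mulr0.
apply/eqP/forall_inP => [u0 i iT|u0].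
  by rewrite -(enum_rankK_in iT iT) -uE u0 mxE.
by apply/rowP=> j; rewrite uE mxE; apply/eqP/u0/enum_valP.
Qed.

Lemma sub_coord_mx T (u : 'rV[F]_n) :
  (u <= coord_mx T)%MS = [forall i in ~: T, u 0 i == 0].
Proof.
apply/idP/forall_inP => [/submxP[a ->] i|u0].
  rewrite inE => iT; rewrite mxE big1 // => j _.
  rewrite !mxE; case: eqP => [ji|]; last by rewrite mulr0.
  by rewrite -ji enum_valP in iT.
rewrite [u]row_sum_delta; apply: summx_sub => i _.
have [iT|iT] := boolP (i \in T); last first.
  by rewrite (eqP (u0 i _)) ?inE // scale0r sub0mx.
apply/scalemx_sub/(eq_row_sub (enum_rank_in iT i)).
by apply/rowP=> j; rewrite !mxE enum_rankK_in // !eqxx eq_sym.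
Qed.

Definition generator_mx C : 'M[F]_(\dim C, n) := \matrix_i (vbasis C)`_i.

Lemma sub_generator_mx C (u : 'rV[F]_n) : (u <= generator_mx C)%MS = (u \in C).
Proof.
apply/submxP/idP => [[a ->]|uC].
  rewrite mulmx_sum_row memv_suml // => i _; rewrite rowK memvZ //.
  by rewrite vbasis_mem // mem_nth // size_tuple.
exists (\row_i coord (vbasis C) i u); rewrite mulmx_sum_row.
by rewrite [LHS](coord_vbasis uC); apply: eq_bigr => i _; rewrite rowK mxE.
Qed.

Lemma self_dual_kermx C (u : 'rV[F]_n) : self_dual C ->
  (u <= kermx (generator_mx C)^T)%MS = (u \in C).
Proof.
move=> /(_ u) ->; rewrite inE sub_kermx; apply/eqP/forall_inP => [u0 v|u0].
  rewrite -sub_generator_mx => /submxP[a ->].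
  have /rowP/(_ 0) : u *m (a *m generator_mx C)^T = 0.
    by rewrite trmx_mul mulmxA u0 mul0mx.
  rewrite !mxE => uv0; apply/eqP; apply: etrans uv0.
  by apply: eq_bigr => i _; rewrite [_^T _ _]mxE.
apply/rowP=> j; have /u0/eqP uj0 : row j (generator_mx C) \in C.
  by rewrite -sub_generator_mx row_sub.
rewrite !mxE; apply: etrans uj0.
by apply: eq_bigr => i _; rewrite !mxE.
Qed.

(* The rank of the restriction of [C] to [T] is counted once as a row rank and
   once as a column rank. *)
Lemma self_dual_vanishing C T : self_dual C ->
  (#|vanishing_on C T| * #|F| ^ #|T| = #|vanishing_on C (~: T)| * #|F| ^ \dim C)%N.
Proof.
move=> Cdual; set G := generator_mx C; set E := coord_mx T.
have dimC : \rank G = \dim C.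
  apply: (@expnI #|F|); first exact: finNzRing_gt1.
  rewrite -card_rowg -card_vspace; apply: eq_card => u.
  by rewrite mem_rowg sub_generator_mx.
have -> : vanishing_on C T = rowg (G :&: kermx E^T)%MS.
  apply/setP=> u; rewrite mem_rowg sub_capmx sub_kermx sub_generator_mx.
  by rewrite mul_coord_tr_eq0 inE.
(* By self-duality [C] is the kernel of [G^T], and the row space of [E] is the space of vectors
   vanishing off [T]. *)
have -> : vanishing_on C (~: T) = rowg (E :&: kermx G^T)%MS.
  apply/setP=> u; rewrite mem_rowg sub_capmx self_dual_kermx // sub_coord_mx.
  by rewrite inE andbC.
rewrite !card_rowg -!expnD; congr (_ ^ _)%N.
have := mxrank_mul_ker G E^T; have := mxrank_mul_ker E G^T.
rewrite dimC [\rank E]rank_coord_mx -(mxrank_tr (G *m E^T)) trmx_mul trmxK.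
move=> rE rG; apply: (@addnI (\rank (E *m G^T))).
by rewrite !addnA rE rG addnC.
Qed.

(** Double counting of the pairs of a codeword and a [j]-set on which it vanishes: a word of weight
    w has n - w zero coordinates. *)
Lemma sum_vanishing C (j : nat) :
  (\sum_(T : {set 'I_n} | #|T| == j) #|vanishing_on C T| =
   \sum_(i < n.+1) weight_count C i * 'C(n - i, j))%N.
Proof.
transitivity (\sum_(c | c \in C) 'C(n - hweight c, j))%N.
  have cardE T : #|vanishing_on C T| =
      (\sum_(c | c \in C) if [forall i in T, (c 0 i == 0)%R] then 1 else 0)%N.
    by rewrite -sum1_card -big_mkcondr; apply: eq_bigl => c; rewrite inE.
  rewrite (eq_bigr _ (fun T _ => cardE T)).
  rewrite exchange_big /=; apply: eq_bigr => c _.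
  rewrite -big_mkcondr sum1_card.
  set Z := [set i | c 0 i == 0].
  have wE : (#|Z| + hweight c = n)%N.
    apply: etrans (card_ord n); rewrite -(cardsC Z).
    by congr (_ + _)%N; apply: eq_card => i; rewrite !inE mxE.
  have -> : (n - hweight c = #|Z|)%N.
    by apply: etrans (addnK (hweight c) _); rewrite wE.
  rewrite -cards_draws; apply: eq_card => T; rewrite !inE andbC; congr andb.
  apply/forall_inP/subsetP => sT i /sT; by rewrite inE.
have wle (c : 'rV[F]_n) : (hweight c < n.+1)%N.
  by rewrite ltnS -[X in (_ <= X)%N]card_ord max_card.
rewrite (partition_big (fun c => Ordinal (wle c)) predT) //=.
apply: eq_bigr => i _; rewrite -sum_nat_const; apply: eq_big => [c|c].
  by rewrite inE -val_eqE.
by case/andP=> _ /eqP <-.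
Qed.

(** This is [self_dual_vanishing] summed over all [T] of size [j]; complementation turns the right
    side into a sum over sets of size [n - j]. *)
Lemma binomial_moment_duality C j : self_dual C -> (j <= n)%N ->
  ((\sum_(i < n.+1) weight_count C i * 'C(n - i, j)) * #|F| ^ j =
   (\sum_(i < n.+1) weight_count C i * 'C(n - i, n - j)) * #|F| ^ \dim C)%N.
Proof.
move=> Cdual jn; rewrite -!sum_vanishing !big_distrl /=.
rewrite [RHS](reindex_inj (@setC_inj _)) /=; apply: eq_big => [T|T /eqP <-].
  rewrite [#|~: T|]cardsCs setCK card_ord.
  have Tn : (#|T| <= n)%N by rewrite -[X in (_ <= X)%N]card_ord max_card.
  by apply/eqP/eqP=> [->//|Tj]; rewrite -(subKn Tn) Tj subKn.
exact: self_dual_vanishing.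
Qed.

(** Take [T] to be the set of all coordinates in [self_dual_vanishing]: only the zero word vanishes
    everywhere. *)
Lemma self_dual_dim C : self_dual C -> n = (\dim C).*2.
Proof.
move=> Cdual; have := self_dual_vanishing C setT Cdual.
have -> : vanishing_on C (~: setT) = [set c in C].
  by apply/setP=> c; rewrite !inE andb_idr // => _; apply/forall_inP=> i; rewrite !inE.
have -> : vanishing_on C setT = [set 0].
  apply/setP=> c; rewrite !inE; apply/andP/eqP => [[_ /forall_inP c0]|->].
    by apply/rowP=> i; rewrite mxE; apply/eqP/c0; rewrite inE.
  by split; [exact: mem0v | apply/forall_inP => i _; rewrite mxE].
rewrite cards1 mul1n cardsT card_ord cardsE card_vspace -expnD addnn.
by apply/expnI/finNzRing_gt1.
Qed.

Lemma weight_count0 C : weight_count C 0 = 1%N.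
Proof.
apply/eqP/cards1P; exists 0; apply/setP=> c; rewrite !inE cards_eq0.
apply/andP/eqP => [[_ /eqP c0]|->]; last first.
  by split; [exact: mem0v | apply/eqP/setP=> i; rewrite !inE eqxx].
apply/rowP=> i; move/setP/(_ i): c0; rewrite !inE => /negbFE/eqP ->.
by [].
Qed.

Lemma weight_count_lt_distance C d i : min_distance C d ->
  (0 < i < d)%N -> weight_count C i = 0%N.
Proof.
case=> _ dmin /andP[i0 id]; apply/eqP; rewrite cards_eq0.
apply/set0Pn => -[c]; rewrite inE => /andP[cC /eqP ci].
have c0 : c != 0.
  apply: contraTneq i0 => c0; rewrite -ci -leqNgt leqn0 cards_eq0 c0.
  by apply/eqP/setP=> k; rewrite !inE eqxx.
by have := dmin c 0 cC (mem0v _) c0; rewrite -/(hweight c) ci leqNgt id.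
Qed.

Lemma weight_count_distance_neq0 C d : min_distance C d -> weight_count C d != 0%N.
Proof.
case=> -[u [v [uC vC _ uvd]]] _; rewrite -lt0n; apply/card_gt0P; exists (u - v).
rewrite inE memvB //=; apply/eqP; rewrite -uvd; apply: eq_card => i.
by rewrite !inE !mxE subr_eq0.
Qed.

(** A codeword of weight one would be orthogonal to itself, so its only nonzero coordinate would
    have square zero. *)
Lemma self_dual_distance_gt1 C d : self_dual C -> min_distance C d -> (1 < d)%N.
Proof.
move=> Cdual [[u [v [uC vC uv duv]]] _].
have d0 : d != 0%N.
  apply: contraNneq uv; rewrite -duv => /eqP; rewrite cards_eq0 => /eqP/setP E.
  apply/eqP/rowP=> i; have := E i; by rewrite !inE => /negbFE/eqP.
have [d1|] := eqVneq d 1%N; last by case: d d0 {duv} => [|[]].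
have /cards1P[i iE] : #|[set i | u 0 i != v 0 i]| == 1%N by apply/eqP; apply: etrans duv d1.
have : u - v \in C by rewrite memvB.
have uvE j : (u - v) 0 j = 0 <-> j != i.
  rewrite !mxE; have := iE => /setP/(_ j); rewrite !inE => <-.
  by rewrite negbK -subr_eq0; split=> /eqP.
rewrite {1}Cdual inE => /forall_inP/(_ (u - v)); rewrite memvB // => /(_ isT).
rewrite (bigD1 i) //= big1 ?addr0 => [|j /uvE ->]; last by rewrite mul0r.
by rewrite mulf_eq0 orbb => /eqP/uvE; rewrite eqxx.
Qed.
End Code.

(** * The zeta expansion in the basis y^(n-j) (x-y)^j *)

Lemma coef_linear_pow (A : comNzRingType) (u v : A) n j :
  ((u%:P + v%:P * 'X) ^+ n)`_j = u ^+ (n - j) * v ^+ j *+ 'C(n, j).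
Proof.
rewrite exprDn coef_sum.
have term (i : 'I_n.+1) : (u%:P ^+ (n - i) * (v%:P * 'X) ^+ i *+ 'C(n, i))`_j =
    u ^+ (n - i) * v ^+ i *+ 'C(n, i) *+ (j == i).
  rewrite coefMn exprMn -!polyC_exp mulrA -polyCM coefCM coefXn.
  by case: eqP => _; rewrite ?mulr1 ?mulr1n // mulr0 mulr0n mul0rn.
rewrite (eq_bigr _ (fun i _ => term i)).
have [jn|jn] := leqP j n.
  rewrite (bigD1 (inord j)) //= inordK // eqxx mulr1n big1 ?addr0 // => i.
  by rewrite -val_eqE /= inordK // eq_sym => /negPf ->.
rewrite bin_small // mulr0n big1 // => i _.
by rewrite (gtn_eqF (leq_ltn_trans _ jn)) // -ltnS.
Qed.

(** Binomial theorem for x = y + (x - y). The range of [j] is the same for every [i], the extra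
    binomials being zero, so that sums over [i] and [j] can be exchanged. *)
Lemma monomial_shift_expansion (A : comNzRingType) (x y : A) (n i : nat) : (i <= n)%N ->
  x ^+ (n - i) * y ^+ i =
  \sum_(j < n.+1) y ^+ (n - j) * (x - y) ^+ j *+ 'C(n - i, j).
Proof.
move=> le_in; rewrite -{1}[x](addrNK y) addrC exprDn big_distrl /=.
rewrite (big_ord_widen n.+1
  (fun j => y ^+ (n - i - j) * (x - y) ^+ j *+ 'C(n - i, j) * y ^+ i));
  last by rewrite ltnS leq_subr.
rewrite big_mkcond /=; apply: eq_bigr => j _; rewrite ltnS.
case: leqP => [ji|ij]; last by rewrite bin_small // mulr0n.
rewrite mulrnAl mulrAC -exprD; congr (_ ^+ _ * _ *+ _).
lia.
Qed.

(** Coefficients of Z(T) = P(T)/((1-T)(1-qT)). The ring is arbitrary because they are taken both in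
    [R] and in [{mpoly R[2]}]. *)
Definition zeta_coef {A : comNzRingType} (q : A) (P : {poly A}) : nat -> A :=
  fps_mul (fps_of_poly P) (fps_mul (fps_geom 1) (fps_geom q)).

Definition zeta_basis {R : realType} (n j : nat) : {mpoly R[2]} :=
  yvar R ^+ (n - j) * (xvar R - yvar R) ^+ j.

Lemma rmorph_zeta_coef (A B : comNzRingType) (phi : {rmorphism A -> B}) q P m :
  phi (zeta_coef q P m) = zeta_coef (phi q) (map_poly phi P) m.
Proof.
rewrite rmorph_sum; apply: eq_bigr => i _.
rewrite rmorphM /fps_of_poly coef_map rmorph_sum; congr (_ * _).
by apply: eq_bigr => k _; rewrite rmorphM /fps_geom !rmorphXn rmorph1.
Qed.

(** Since y(1-T) + xT = y + (x-y)T, the coefficient of T^j in its n-th power is C(n,j) times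
    [zeta_basis n j]. *)
Lemma zeta_expansionE (R : realType) (q n N : nat) (P : {poly R}) :
  zeta_expansion q n P N =
  \sum_(j < N.+1) (zeta_coef q%:R P (N - j) * 'C(n, j)%:R) *: zeta_basis n j.
Proof.
rewrite /zeta_expansion /fps_mul (reindex_inj rev_ord_inj) /=.
apply: eq_bigr => j _; have jN : (j <= N)%N by rewrite -ltnS.
rewrite subSS subKn //.
have -> : (yvar R)%:P * (1 - 'X) + (xvar R)%:P * 'X =
    (yvar R)%:P + (xvar R - yvar R)%:P * 'X.
  by rewrite polyCB; ring.
rewrite -[X in X * _]/(zeta_coef q%:R (map_poly (@mpolyC 2 R) P) (N - j)).
rewrite -(rmorph_nat (@mpolyC 2 R)) -rmorph_zeta_coef.
rewrite [X in _ * X]coef_linear_pow -/(zeta_basis n j).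
by rewrite mul_mpolyC -scaler_nat scalerA.
Qed.

(** * Passing between P and the coefficients of its zeta function *)

Section Recursion.
Context {A : comNzRingType}.
Implicit Types (q : A) (P : {poly A}) (f : nat -> A).

Lemma fps_mul_geom q m :
  fps_mul (fps_geom 1) (fps_geom q) m.+1 =
  q * fps_mul (fps_geom 1) (fps_geom q) m + 1.
Proof.
rewrite /fps_mul /fps_geom big_ord_recr /= expr1n mul1r subnn expr0 mulr_sumr.
congr (_ + _); apply: eq_bigr => i _.
by rewrite !expr1n !mul1r subSn ?exprS // -ltnS.
Qed.

(* Multiplication by (1 - T)(1 - qT). *)
Definition zeta_numerator q f m : A :=
  match m with
  | 0 => f 0%N
  | 1 => f 1%N - (q + 1) * f 0%N
  | m'.+2 => f m'.+2 - (q + 1) * f m'.+1 + q * f m'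
  end.

(** The coefficients h_k = 1 + q + ... + q^k of 1/((1-T)(1-qT)) satisfy h_(k+2) = (q+1) h_(k+1) - q
    h_k, so the convolution sums cancel up to their last terms. *)
Lemma zeta_numerator_coef q P m : zeta_numerator q (zeta_coef q P) m = P`_m.
Proof.
have h0 : fps_mul (fps_geom 1) (fps_geom q) 0 = 1.
  by rewrite /fps_mul big_ord1 mulr1.
have h1 : fps_mul (fps_geom 1) (fps_geom q) 1 = q + 1.
  by rewrite fps_mul_geom h0 mulr1.
have h2 k : fps_mul (fps_geom 1) (fps_geom q) k.+2 =
    (q + 1) * fps_mul (fps_geom 1) (fps_geom q) k.+1 -
    q * fps_mul (fps_geom 1) (fps_geom q) k.
  by rewrite !fps_mul_geom; ring.
set h := fps_mul _ _ in h0 h1 h2 *.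
have zE k : zeta_coef q P k = \sum_(i < k.+1) P`_i * h (k - i)%N by [].
case: m => [|[|m]]; rewrite /zeta_numerator !zE.
- by rewrite big_ord1 h0 mulr1.
- by rewrite big_ord_recl !big_ord1 /= subn0 h0 h1; ring.
rewrite [\sum_(i < m.+3) _]big_ord_recr ![\sum_(i < m.+2) _]big_ord_recr /=.
rewrite !subnn subSnn h0 h1.
have -> : \sum_(i < m.+1) P`_i * h (m.+2 - i)%N =
    (q + 1) * (\sum_(i < m.+1) P`_i * h (m.+1 - i)%N) -
    q * (\sum_(i < m.+1) P`_i * h (m - i)%N).
  rewrite !mulr_sumr -sumrB; apply: eq_bigr => i _.
  have im : (i <= m)%N by rewrite -ltnS.
  by rewrite subSn ?leqW // subSn // h2; ring.
by ring.
Qed.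

(** The factor (1-T)(1-qT) has constant term 1, so multiplication by it is unitriangular on
    coefficients and can be inverted up to any order [N]. *)
Lemma eq_zeta_coef q P f N :
  (forall m, (m <= N)%N -> zeta_coef q P m = f m) <->
  (forall m, (m <= N)%N -> P`_m = zeta_numerator q f m).
Proof.
split=> H m mN.
  by rewrite -(zeta_numerator_coef q); case: m mN => [|[|m]] mN /=; rewrite !H //; lia.
elim/ltn_ind: m mN => m IH mN; have := H _ mN.
rewrite -(zeta_numerator_coef q); case: m IH mN => [|[|m]] IH mN //=.
  by rewrite (IH 0%N) // => /addIr.
have -> : zeta_coef q P m = f m by apply: IH; lia.
have -> : zeta_coef q P m.+1 = f m.+1 by apply: IH; lia.
by move=> /addIr/addIr.
Qed.
End Recursion.

(** * Comparison of coefficients and binomial moments *)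

Section Basis.
Context {R : realType}.

Lemma zeta_basis_free n (a b : nat -> R) :
  \sum_(j < n.+1) a j *: zeta_basis n j = \sum_(j < n.+1) b j *: zeta_basis n j ->
  forall j, (j <= n)%N -> a j = b j.
Proof.
(* The substitution x = 1 + X, y = 1 sends [zeta_basis n j] to X^j. *)
pose h (i : 'I_2) : {poly R} := if i == ord0 then 1 + 'X else 1.
pose phi := mmap polyC h.
have phiE (c : nat -> R) : phi (\sum_(j < n.+1) c j *: zeta_basis n j) =
    \poly_(j < n.+1) c j.
  rewrite poly_def /phi rmorph_sum; apply: eq_bigr => j _.
  rewrite /= mmapZ rmorphM !rmorphXn rmorphB /= !mmapX !mmap1U /h /=.
  by rewrite expr1n mul1r addrAC subrr add0r mul_polyC.
move=> /(congr1 phi); rewrite !phiE => /polyP ab j jn.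
by have := ab j; rewrite !coef_poly ltnS jn.
Qed.

Definition binomial_moment (A : nat -> nat) (n j : nat) : nat :=
  \sum_(i < n.+1) A i * 'C(n - i, j).

Lemma monomial_zeta_basis n i : (i <= n)%N ->
  xvar R ^+ (n - i) * yvar R ^+ i = \sum_(j < n.+1) 'C(n - i, j)%:R *: zeta_basis n j.
Proof.
move=> le_in; rewrite [LHS](monomial_shift_expansion _ _ _ _ _ le_in).
by apply: eq_bigr => j _; rewrite scaler_nat.
Qed.

Lemma weight_enumerator_expansion (F : finFieldType) n (C : {vspace 'rV[F]_n}) :
  weight_enumerator R C =
  \sum_(j < n.+1) (binomial_moment (weight_count C) n j)%:R *: zeta_basis n j.
Proof.
transitivity (\sum_(i < n.+1) \sum_(j < n.+1)
    (weight_count C i * 'C(n - i, j))%:R *: @zeta_basis R n j).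
  apply: eq_bigr => i _; have le_in : (i <= n)%N by rewrite -ltnS.
  rewrite monomial_zeta_basis // scaler_sumr.
  by apply: eq_bigr => j _; rewrite scalerA natrM.
by rewrite exchange_big; apply: eq_bigr => j _; rewrite natr_sum scaler_suml.
Qed.

(** Both sides are expanded in [zeta_basis]. An index j <= n - d gives the zeta coefficient of index
    m = n - d - j; for larger j the expansion has no term, and the assumption on the moments makes
    the coefficient of W - x^n vanish as well. *)
Lemma zeta_conditionP (F : finFieldType) (q n d : nat) (C : {vspace 'rV[F]_n})
    (P : {poly R}) : (d <= n)%N ->
  (forall j, (n - d < j <= n)%N -> binomial_moment (weight_count C) n j = 'C(n, j)) ->
  zeta_condition q n d (weight_enumerator R C) P <->
  (size P <= (n - d).+1)%N /\
  forall m, (m <= n - d)%N -> zeta_coef q%:R P m =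
    ((binomial_moment (weight_count C) n (n - d - m))%:R / 'C(n, n - d - m)%:R - 1)
    / (q%:R - 1).
Proof.
move=> dn momE; set B := binomial_moment _ n in momE *.
have xE : xvar R ^+ n = \sum_(j < n.+1) 'C(n, j)%:R *: zeta_basis n j.
  by have := monomial_zeta_basis n 0 (leq0n n); rewrite subn0 mulr1.
have bin_neq0 j : (j <= n)%N -> 'C(n, j)%:R != 0 :> R.
  by move=> jn; rewrite pnatr_eq0 -lt0n bin_gt0.
pose a j : R :=
  if (j <= n - d)%N then zeta_coef q%:R P (n - d - j) * 'C(n, j)%:R else 0.
pose b j : R := (q%:R - 1)^-1 * ((B j)%:R - 'C(n, j)%:R).
have lhsE : zeta_expansion q n P (n - d) = \sum_(j < n.+1) a j *: zeta_basis n j.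
  rewrite zeta_expansionE.
  rewrite (big_ord_widen n.+1
    (fun j => (zeta_coef q%:R P (n - d - j) * 'C(n, j)%:R) *: zeta_basis n j));
    last by rewrite ltnS leq_subr.
  rewrite big_mkcond /=; apply: eq_bigr => j _; rewrite /a ltnS.
  by case: leqP; rewrite ?scale0r.
have rhsE : (q%:R - 1)^-1 *: (weight_enumerator R C - xvar R ^+ n) =
    \sum_(j < n.+1) b j *: zeta_basis n j.
  rewrite weight_enumerator_expansion xE -sumrB scaler_sumr.
  by apply: eq_bigr => j _; rewrite -scalerBl scalerA.
rewrite /zeta_condition lhsE rhsE.
have abE : (forall j, (j <= n)%N -> a j = b j) <-> forall m, (m <= n - d)%N ->
    zeta_coef q%:R P m = ((B (n - d - m)%N)%:R / 'C(n, n - d - m)%:R - 1) / (q%:R - 1).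
  split=> H.
    move=> m mn; have jn : (n - d - m <= n)%N by lia.
    have := H _ jn; rewrite /a /b leq_subr subKn // => E.
    apply: (mulIf (bin_neq0 _ jn)); rewrite E mulrAC mulrBl mul1r divfK ?bin_neq0 //.
    by rewrite mulrC.
  move=> j jn; rewrite /a /b; case: leqP => jd.
    rewrite H ?leq_subr // subKn // mulrAC mulrBl mul1r divfK ?bin_neq0 //.
    by rewrite mulrC.
  by rewrite momE ?jd // subrr mulr0.
split=> -[sP H]; split=> //.
  exact/abE/zeta_basis_free.
by apply: eq_bigr => j _; rewrite (proj2 abE H) // -ltnS.
Qed.

End Basis.

(** * Palindromic sextics and their trace cubics *)

Definition palindromic_sextic {R : nzRingType} (q a b c e : R) : {poly R} :=
  a%:P + b *: 'X + c *: 'X^2 + e *: 'X^3 + (q * c) *: 'X^4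
  + (q ^+ 2 * b) *: 'X^5 + (q ^+ 3 * a) *: 'X^6.

(* P(T) / T^3 as a function of - (1 / T + q T), up to sign. *)
Definition trace_cubic {R : nzRingType} (q a b c e : R) : {poly R} :=
  a *: 'X^3 - b *: 'X^2 + (c - 3 * q * a) *: 'X - (e - 2 * q * b)%:P.

Section Roots.
Context {R : realType}.
Implicit Types (q x : R) (z w : R[i]).
Local Notation "x %:C" := (real_complex R x).

Lemma horner_palindromic_sextic q a b c e z : z != 0 ->
  (map_poly (real_complex R) (palindromic_sextic q a b c e)).[z] =
  - z ^+ 3 * (map_poly (real_complex R) (trace_cubic q a b c e)).[- (z^-1 + q%:C * z)].
Proof.
move=> z0; rewrite /palindromic_sextic /trace_cubic.
rewrite !(rmorphD, rmorphB, rmorphN) /= !map_polyC !map_polyZ !map_polyXn map_polyX /=.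
rewrite !hornerE !(rmorphD, rmorphB, rmorphN, rmorphM, rmorphXn, rmorph_nat) /=.
by field.
Qed.

Lemma normc_inv_sqrtE q z : 0 < q ->
  `|z| = ((Num.sqrt q)^-1)%:C <-> q * (complex.Re z ^+ 2 + complex.Im z ^+ 2) = 1.
Proof.
move=> q0; have z0 : 0 <= complex.Re z ^+ 2 + complex.Im z ^+ 2.
  by rewrite addr_ge0 ?sqr_ge0.
rewrite normc_def -sqrtrV ?ltW //; split=> [/complexI/(congr1 (fun x => x ^+ 2))|qz].
  by rewrite !sqr_sqrtr ?invr_ge0 ?(ltW q0) // => ->; rewrite mulfV ?gt_eqF.
congr real_complex_def; congr Num.sqrt.
by apply: (mulfI (lt0r_neq0 q0)); rewrite qz mulfV ?gt_eqF.
Qed.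

Lemma trace_in_interval q z : 0 < q -> `|z| = ((Num.sqrt q)^-1)%:C ->
  exists x : R, - (z^-1 + q%:C * z) = x%:C /\
    - (2 * Num.sqrt q) <= x <= 2 * Num.sqrt q.
Proof.
move=> q0 /(normc_inv_sqrtE q z q0); case: z => a b /= qab.
(* As q |z|^2 = 1, the inverse of z is q times its conjugate, so 1/z + qz = 2q Re z. *)
exists (- (2 * q * a)); split.
  have ab0 : a ^+ 2 + b ^+ 2 != 0.
    by apply: contra_eq_neq qab => ->; rewrite mulr0 eq_sym oner_eq0.
  have -> : (Complex a b)^-1 = Complex (q * a) (- (q * b)).
    have qE : q = (a ^+ 2 + b ^+ 2)^-1 by rewrite -[RHS]mul1r -qab mulfK.
    by rewrite qE; congr Complex; rewrite mulrC ?mulNr.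
  by apply/eqP; rewrite eq_complex /=; apply/andP; split; apply/eqP; ring.
rewrite -ler_norml normrN -sqrtr_sqr.
have -> : 2 * Num.sqrt q = Num.sqrt (2 ^+ 2 * q).
  by rewrite sqrtrM ?sqr_ge0 // sqrtr_sqr ger0_norm.
(* The bound comes from q a^2 <= q (a^2 + b^2) = 1. *)
by apply: ler_wsqrtr; nra.
Qed.

(** The discriminant [x ^+ 2 - 4 * q] is at most 0, so the two roots are conjugate or equal, and
    their product is 1/q. *)
Lemma root_real_trace q x z : 0 < q -> - (2 * Num.sqrt q) <= x <= 2 * Num.sqrt q ->
  q%:C * z ^+ 2 + x%:C * z + 1 = 0 -> `|z| = ((Num.sqrt q)^-1)%:C.
Proof.
move=> q0 xq zE; apply/(normc_inv_sqrtE q z q0).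
have {xq} xq : x ^+ 2 <= 4 * q.
  move: xq; rewrite -ler_norml => xq.
  rewrite -real_normK ?num_real // -(sqr_sqrtr (ltW q0)).
  rewrite -[4]/((2 * 2)%N%:R) natrM -expr2 -exprMn.
  by rewrite lerXn2r // nnegrE ?mulr_ge0 ?sqrtr_ge0.
case: z zE => a b /=; rewrite expr2 /= => /eqP.
rewrite eq_complex /= => /andP[/eqP re /eqP im].
have {im} im : b * (2 * q * a + x) = 0 by rewrite -[RHS]im; ring.
have {re} re : q * (a ^+ 2 - b ^+ 2) + x * a + 1 = 0 by rewrite -[RHS]re; ring.
(* If b is nonzero, then x = -2qa and the real part becomes q (a^2 + b^2) = 1. If b = 0, the
   discriminant is the square of 2qa + x, hence zero, and x = -2qa again. *)
have [b0|b0] := eqVneq b 0; last first.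
  have xE : x = - (2 * q * a).
    by apply/eqP; rewrite -addr_eq0 addrC; move/eqP: im; rewrite mulf_eq0 (negPf b0).
  by move: re; rewrite xE => re; lra.
rewrite b0 expr0n /= ?subr0 ?addr0 in re *.
have sqE : (2 * q * a + x) ^+ 2 = x ^+ 2 - 4 * q.
  apply/eqP; rewrite -subr_eq0; apply/eqP.
  by transitivity (4 * q * (q * a ^+ 2 + x * a + 1)); [ring | rewrite re mulr0].
have : (2 * q * a + x) ^+ 2 == 0.
  by rewrite eq_le sqr_ge0 andbT sqE subr_le0.
rewrite sqrf_eq0 addrC addr_eq0 => /eqP xE.
by move: re; rewrite xE => re; lra.
Qed.

(** Every complex w equals -(1/z + qz) for some nonzero z, so the roots of the cubic are the images
    of those of the sextic. The condition [a != 0] keeps 0 from being a root of the sextic. *)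
Lemma palindromic_sextic_rootsP (q a b c e : R) : 0 < q -> a != 0 ->
  (forall z, root (map_poly (real_complex R) (palindromic_sextic q a b c e)) z ->
     `|z| = ((Num.sqrt q)^-1)%:C) <->
  all_roots_in (trace_cubic q a b c e) (- (2 * Num.sqrt q)) (2 * Num.sqrt q).
Proof.
move=> q0 a0; have qC0 : q%:C != 0 by rewrite fmorph_eq0 gt_eqF.
split=> [rhP w /rootP w0|rootsP z /rootP Pz0].
  (* Quadratic formula for q z^2 + w z + 1 = 0, which is w = -(1/z + qz) with denominators
     cleared. *)
  pose s := sqrtc (w ^+ 2 - 4 * q%:C); pose z := (s - w) / (2 * q%:C).
  have zE : q%:C * z ^+ 2 + w * z + 1 = 0.
    have sE : s ^+ 2 = w ^+ 2 - 4 * q%:C by rewrite sqr_sqrtc.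
    transitivity ((s ^+ 2 - (w ^+ 2 - 4 * q%:C)) / (4 * q%:C)).
      by rewrite /z; field.
    by rewrite sE subrr mul0r.
  have z0 : z != 0.
    by apply: contra_eq_neq zE => ->; rewrite expr0n /= !mulr0 !add0r oner_eq0.
  have wE : - (z^-1 + q%:C * z) = w.
    apply/eqP; rewrite -subr_eq0; apply/eqP.
    transitivity (- (q%:C * z ^+ 2 + w * z + 1) / z); first by field.
    by rewrite zE oppr0 mul0r.
  have [|x [xE xq]] := trace_in_interval q z q0.
    by apply: rhP; apply/rootP; rewrite horner_palindromic_sextic // wE w0 mulr0.
  by exists x; rewrite -xE wE.
have z0 : z != 0.
  apply: contra_eq_neq Pz0 => ->; rewrite horner_coef0 coef_map /=.
  by rewrite /palindromic_sextic !coefE /= !mulr0 !addr0 fmorph_eq0.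
have /eqP := Pz0; rewrite horner_palindromic_sextic // mulf_eq0 oppr_eq0.
rewrite expf_eq0 (negPf z0) /= => /rootsP[x [xE xq]].
apply: (root_real_trace q x) => //; rewrite -xE.
by field.
Qed.

End Roots.

(** * Moments and zeta coefficients in genus 3 *)

Lemma binomial_moment_from (A : nat -> nat) n d j :
  A 0%N = 1%N -> (forall i, (0 < i < d)%N -> A i = 0%N) -> (0 < d <= n)%N ->
  binomial_moment A n j = ('C(n, j) + \sum_(d <= i < n.+1) A i * 'C(n - i, j))%N.
Proof.
move=> A0 Ad /andP[d0 dn].
rewrite /binomial_moment -(big_mkord predT (fun i => A i * 'C(n - i, j))%N).
rewrite (@big_cat_nat _ _ _ d) /=; [|by []|by rewrite ltnW].
rewrite big_ltn // A0 mul1n subn0 big_nat_cond big1 ?addn0 // => i /andP[/Ad ->].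
by rewrite mul0n.
Qed.

Section ExplicitZeta.
Context {R : realType} (q d : nat) (A : nat -> nat).
Context (q_gt1 : (1 < q)%N) (d_gt1 : (1 < d)%N) (A0 : A 0%N = 1%N)
  (A_lt_d : forall i, (0 < i < d)%N -> A i = 0%N)
  (A_duality : forall j, (j <= 2 * d + 4)%N ->
     (binomial_moment A (2 * d + 4) j * q ^ j =
      binomial_moment A (2 * d + 4) (2 * d + 4 - j) * q ^ (d + 2))%N).

Local Notation n := (2 * d + 4)%N.
Local Notation N := (binomial_moment A n).
Let Q : R := q%:R.
Let D : R := d%:R.
Let B : R := 'C(n, d + 4)%:R.

(* Coefficient of T^m in the zeta function of a code with weight distribution [A]. *)
Definition zeta_target (m : nat) : R :=
  ((N (n - d - m))%:R / 'C(n, n - d - m)%:R - 1) / (Q - 1).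
Local Notation f := zeta_target.

(** A word of weight at least [d] has at most [n - d = d + 4] zero coordinates, so only weight 0
    contributes. *)
Lemma moment_large j : (d + 4 < j)%N -> N j = 'C(n, j).
Proof.
move=> dj; rewrite (binomial_moment_from _ _ d) //; last by lia.
rewrite big_nat_cond big1 ?addn0 // => i /andP[/andP[di _] _].
by rewrite bin_small ?muln0 //; lia.
Qed.

Lemma moment_d4 : N (d + 4) = ('C(n, d + 4) + A d)%N.
Proof.
rewrite (binomial_moment_from _ _ d) //; last by lia.
rewrite big_ltn; last by lia.
have -> : (n - d = d + 4)%N by lia.
rewrite binn muln1 big_nat_cond big1 ?addn0 // => i /andP[/andP[di _] _].
by rewrite bin_small ?muln0 //; lia.
Qed.

Lemma moment_d3 : N (d + 3) = ('C(n, d + 3) + (A d * (d + 4) + A d.+1))%N.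
Proof.
rewrite (binomial_moment_from _ _ d) //; last by lia.
rewrite big_ltn; last by lia.
rewrite big_ltn; last by lia.
have -> : (n - d = (d + 3).+1)%N by lia.
have -> : (n - d.+1 = d + 3)%N by lia.
rewrite binSn binn muln1 big_nat_cond big1 ?addn0 => [|i /andP[/andP[di _] _]].
  by congr (_ + (_ * _ + _))%N; lia.
by rewrite bin_small ?muln0 //; lia.
Qed.

Lemma moment_d2 : N (d + 2) =
  ('C(n, d + 2) + (A d * 'C(d + 4, 2) + (A d.+1 * (d + 3) + A d.+2)))%N.
Proof.
rewrite (binomial_moment_from _ _ d) //; last by lia.
rewrite big_ltn; last by lia.
rewrite big_ltn; last by lia.
rewrite big_ltn; last by lia.
have -> : (n - d = d + 4)%N by lia.
have -> : (n - d.+1 = (d + 2).+1)%N by lia.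
have -> : (n - d.+2 = d + 2)%N by lia.
rewrite -(@bin_sub (d + 4) 2); last by lia.
have -> : (d + 4 - 2 = d + 2)%N by lia.
rewrite binSn binn muln1 big_nat_cond big1 ?addn0 => [|i /andP[/andP[di _] _]].
  by congr (_ + (_ + (_ * _ + _)))%N; lia.
by rewrite bin_small ?muln0 //; lia.
Qed.

(** Ratios of consecutive binomials, used to give [f 0], [f 1] and [f 2] the common factor
    [1 / ((Q - 1) * B)]. *)
Lemma bin_dE : 'C(n, d + 3)%:R = (D + 4) / (D + 1) * B /\
  'C(n, d + 2)%:R = (D + 4) * (D + 3) / ((D + 1) * (D + 2)) * B.
Proof.
have D0 : 0 <= D by rewrite ler0n.
have H k : (d + k <= n)%N -> ((d + k).+1)%:R * 'C(n, (d + k).+1)%:R =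
    (n - (d + k))%:R * 'C(n, d + k)%:R :> R.
  by move=> kn; rewrite -!natrM mul_bin_left.
have H3 : (D + 4) * B = (D + 1) * 'C(n, d + 3)%:R.
  have := H 3%N; rewrite -addnS -/B.
  have -> : (n - (d + 3) = d + 1)%N by lia.
  by rewrite !natrD => -> //; lia.
have H2 : (D + 3) * 'C(n, d + 3)%:R = (D + 2) * 'C(n, d + 2)%:R.
  have := H 2%N; rewrite -addnS.
  have -> : (n - (d + 2) = d + 2)%N by lia.
  by rewrite !natrD => -> //; lia.
have E3 : 'C(n, d + 3)%:R = (D + 4) / (D + 1) * B.
  have D1 : D + 1 != 0 by lra.
  by apply: (mulfI D1); rewrite -H3; field.
split=> //; have D2 : D + 2 != 0 by lra.
apply: (mulfI D2); rewrite -H2 E3; field; apply/andP; split; lra.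
Qed.

Lemma Q_gt1 : 1 < Q. Proof. by rewrite ltr1n. Qed.
Lemma B_neq0 : B != 0. Proof. by rewrite pnatr_eq0 -lt0n bin_gt0; lia. Qed.

Lemma target0 : f 0 = (A d)%:R / ((Q - 1) * B).
Proof.
rewrite /f subn0; have -> : (n - d = d + 4)%N by lia.
rewrite moment_d4 natrD -/B.
have B0 := B_neq0; have Q1 := Q_gt1.
by field; rewrite B0 subr_eq0 gt_eqF.
Qed.

Lemma target1 : f 1 = (D + 1) / (D + 4) * ((D + 4) * (A d)%:R + (A d.+1)%:R) / ((Q - 1) * B).
Proof.
rewrite /f; have -> : (n - d - 1 = d + 3)%N by lia.
rewrite moment_d3 !natrD natrM natrD (proj1 bin_dE) -/D.
have B0 := B_neq0; have Q1 := Q_gt1.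
have D0 : 0 <= D by rewrite ler0n.
by field; rewrite B0 subr_eq0 gt_eqF //=; apply/andP; split; lra.
Qed.

Lemma target2 : f 2 = (D + 1) * (D + 2) / ((D + 3) * (D + 4)) *
  ((D + 4) * (D + 3) / 2 * (A d)%:R + (D + 3) * (A d.+1)%:R + (A d.+2)%:R) / ((Q - 1) * B).
Proof.
rewrite /f; have -> : (n - d - 2 = d + 2)%N by lia.
have bin2E : 'C(d + 4, 2)%:R = (D + 4) * (D + 3) / 2 :> R.
  have E : (2 * 'C(d + 4, 2) = (d + 4) * (d + 3))%N.
    by rewrite -(@mul_bin_diag (d + 4) 1) bin1; congr muln; lia.
  have : (2 * 'C(d + 4, 2))%:R = ((d + 4) * (d + 3))%:R :> R by rewrite E.
  by rewrite !natrM !natrD -/D => E'; lra.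
rewrite moment_d2 !natrD !natrM bin2E natrD (proj2 bin_dE) -/D.
have B0 := B_neq0; have Q1 := Q_gt1.
have D0 : 0 <= D by rewrite ler0n.
field; rewrite B0 subr_eq0 gt_eqF //=.
by repeat (apply/andP; split); lra.
Qed.

(** Duality exchanges the moments of orders n - d - m and d + m. As d + m = n - d - (4 - m), this
    relates the indices m and 4 - m when m <= 4; for m >= 5 [moment_large] applies. *)
Lemma target_dual m : (2 <= m <= d + 4)%N ->
  f m = (Q ^+ (m - 2) * ((N (d + m))%:R / 'C(n, d + m)%:R) - 1) / (Q - 1).
Proof.
move=> /andP[m2 md]; rewrite /f; have jn : (n - d - m <= n)%N by lia.
rewrite -(bin_sub jn); have := A_duality _ jn.
have -> : (n - (n - d - m) = d + m)%N by lia.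
have -> : (d + 2 = (m - 2) + (n - d - m))%N by lia.
rewrite expnD mulnA => /eqP; rewrite eqn_pmul2r; last by rewrite expn_gt0; lia.
by move=> /eqP ->; rewrite natrM natrX mulrA [_ * Q ^+ _]mulrC.
Qed.

Lemma bin_neq0R j : (j <= n)%N -> 'C(n, j)%:R != 0 :> R.
Proof. by move=> jn; rewrite pnatr_eq0 -lt0n bin_gt0. Qed.

Lemma target3 : f 3 = Q * f 1 + 1.
Proof.
rewrite target_dual; last by lia.
rewrite /f expr1; have -> : (n - d - 1 = d + 3)%N by lia.
have Q1 := Q_gt1; field.
by rewrite bin_neq0R ?subr_eq0 ?gt_eqF //; lia.
Qed.

Lemma target4 : f 4 = Q ^+ 2 * f 0 + (Q + 1).
Proof.
rewrite target_dual; last by lia.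
rewrite /f subn0; have -> : (n - d = d + 4)%N by lia.
have Q1 := Q_gt1; field.
by rewrite bin_neq0R ?subr_eq0 ?gt_eqF //; lia.
Qed.

Lemma target_large m : (5 <= m <= d + 4)%N -> f m = (Q ^+ (m - 2) - 1) / (Q - 1).
Proof.
move=> m5; rewrite target_dual; last by lia.
by rewrite moment_large ?divff ?mulr1 ?bin_neq0R //; lia.
Qed.

(** The four parameters are the coefficients of (1-T)(1-qT) Z(T) in degrees 0 to 3, with [f 3]
    eliminated by [target3]. *)
Definition explicit_zeta : {poly R} :=
  palindromic_sextic Q (f 0) (f 1 - (Q + 1) * f 0) (f 2 - (Q + 1) * f 1 + Q * f 0)
    (2 * Q * f 1 + 1 - (Q + 1) * f 2).

Lemma coef_explicit_zeta m : (m <= d + 4)%N ->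
  explicit_zeta`_m = zeta_numerator Q f m.
Proof.
move=> md; have Q1 := Q_gt1.
have Q10 : Q - 1 != 0 by rewrite subr_eq0 gt_eqF.
rewrite /explicit_zeta /palindromic_sextic !(coefD, coefZ, coefC, coefX, coefXn).
case: m md => [|[|[|[|[|[|[|m]]]]]]] md /=; rewrite ?mulr0 ?mulr1 ?addr0 ?add0r //.
- by rewrite target3; ring.
- by rewrite target4 target3; ring.
- by rewrite (target_large 5) // target4 target3; field.
- by rewrite (target_large 6) ?(target_large 5) ?target4 //; [field | lia].
(* From degree 7 on, only the values (q^(m-2) - 1)/(q - 1) enter; they satisfy the recurrence with
   characteristic roots 1 and q, so the numerator vanishes. *)
- rewrite (target_large m.+3.+4) ?(target_large m.+2.+4) ?(target_large m.+1.+4) //; try lia.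
  by rewrite !subSS !subn0 !exprS; field.
Qed.

Lemma size_explicit_zeta : (size explicit_zeta <= d + 5)%N.
Proof.
(* Here [1 < d] matters: degree 6 must not exceed [n - d = d + 4]. *)
apply: (@leq_trans 7); last by lia.
apply/leq_sizeP => j; rewrite /explicit_zeta /palindromic_sextic.
rewrite !(coefD, coefZ, coefC, coefX, coefXn).
by case: j => [|[|[|[|[|[|[|m]]]]]]] //= _; rewrite !mulr0 !addr0.
Qed.

(** The factor [(Q - 1) * B] clears the denominators of [f 0], [f 1], [f 2], and turns the constant
    1 in the T^3 coefficient into the binomial term of [f0]. *)
Lemma cubic_trace_cubic : cubic R q d A = ((Q - 1) * B) *:
  trace_cubic Q (f 0) (f 1 - (Q + 1) * f 0) (f 2 - (Q + 1) * f 1 + Q * f 0)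
    (2 * Q * f 1 + 1 - (Q + 1) * f 2).
Proof.
have D0 : 0 <= D by rewrite ler0n.
have Q1 := Q_gt1; have B0 := B_neq0.
have D3 : D + 3 != 0 by lra.
have D4 : D + 4 != 0 by lra.
have Q10 : Q - 1 != 0 by lra.
set p0 := f 0; set p1 := f 1 - _; set p2 := f 2 - _ + _; set p3 := 2 * Q * _ + _ - _.
have e3 : f3 R d A = (Q - 1) * B * p0.
  by rewrite /p0 target0 /f3; field; rewrite ?Q10 ?B0 ?D3 ?D4.
have e2 : f2 R q d A = - ((Q - 1) * B * p1).
  by rewrite /p1 /p0 target1 target0 /f2 -/Q -/D; field; rewrite ?Q10 ?B0 ?D3 ?D4.
have e1 : f1 R q d A = (Q - 1) * B * (p2 - 3 * Q * p0).
  rewrite /p2 /p0 target2 target1 target0 /f1 -/Q -/D.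
  by field; rewrite ?Q10 ?B0 ?D3 ?D4.
have e0 : f0 R q d A = - ((Q - 1) * B * (p3 - 2 * Q * p1)).
  rewrite /p3 /p1 /p0 target2 target1 target0 /f0 -/Q -/D -/B.
  by field; rewrite ?Q10 ?B0 ?D3 ?D4.
rewrite /cubic e3 e2 e1 e0 /trace_cubic -!mul_polyC !(polyCM, polyCB, polyCN).
by ring.
Qed.

End ExplicitZeta.


(** * Application to the code, with uniqueness of its zeta polynomial *)

Lemma all_roots_inZ (R : realType) (k : R) (p : {poly R}) (a b : R) : k != 0 ->
  all_roots_in (k *: p) a b <-> all_roots_in p a b.
Proof.
move=> k0; have rootE z : root (map_poly (real_complex R) (k *: p)) z =
    root (map_poly (real_complex R) p) z.
  by rewrite map_polyZ /= rootZ // fmorph_eq0.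
by split=> H z; have := H z; rewrite rootE.
Qed.

Theorem theorem1p6 (R : realType) (q d : nat) (F : finFieldType)
    (cardF : #|F| = q) (C : {vspace 'rV[F]_(2 * d + 4)})
    (C_self_dual : self_dual C) (C_dist : min_distance C d) :
  riemann_hypothesis q (2 * d + 4) d (weight_enumerator R C) <->
  all_roots_in (cubic R q d (weight_count C))
    (- (2 * Num.sqrt q%:R)) (2 * Num.sqrt q%:R).
Proof.
have q_gt1 : (1 < q)%N by rewrite -cardF finNzRing_gt1.
have d_gt1 := self_dual_distance_gt1 C d C_self_dual C_dist.
have dimC : \dim C = (d + 2)%N.
  by have := self_dual_dim C C_self_dual; lia.
have A0 := weight_count0 C.
have A_lt_d i := weight_count_lt_distance C d i C_dist.
have A_duality j (jn : (j <= 2 * d + 4)%N) :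
    (binomial_moment (weight_count C) (2 * d + 4) j * q ^ j =
     binomial_moment (weight_count C) (2 * d + 4) (2 * d + 4 - j) * q ^ (d + 2))%N.
  by rewrite -cardF -dimC; exact: binomial_moment_duality.
have nd : (2 * d + 4 - d = d + 4)%N by lia.
have zetaP P : zeta_condition q (2 * d + 4) d (weight_enumerator R C) P <->
    (size P <= d + 5)%N /\ forall m, (m <= d + 4)%N ->
      zeta_coef q%:R P m = zeta_target (R := R) q d (weight_count C) m.
  rewrite zeta_conditionP; last 2 first.
  - by lia.
  - by move=> j; rewrite nd => /andP[dj _]; apply: moment_large.
  by rewrite /zeta_target nd -(addnS d 4).
pose P0 := explicit_zeta (R := R) q d (weight_count C).
have sP0 : (size P0 <= d + 5)%N by apply: size_explicit_zeta.
have P0_zeta : is_zeta_polynomial q (2 * d + 4) d (weight_enumerator R C) P0.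
  split=> [|P].
    apply/zetaP; split=> //.
    by apply/eq_zeta_coef => m md; apply: coef_explicit_zeta.
  (* The coefficients up to degree d + 4 are forced, and the size bounds kill the others. *)
  move=> /zetaP[sP /eq_zeta_coef PE]; apply/polyP => m.
  have [md|md] := leqP m (d + 4).
    by rewrite PE //; apply: coef_explicit_zeta.
  by rewrite !nth_default ?(leq_trans sP) ?(leq_trans sP0) //; lia.
have Q_gt0 : 0 < q%:R :> R by rewrite ltr0n; lia.
have k_neq0 : (q%:R - 1) * 'C(2 * d + 4, d + 4)%:R != 0 :> R.
  by rewrite mulf_neq0 ?pnatr_eq0 -?lt0n ?bin_gt0 ?subr_eq0 ?pnatr_eq1 ?gtn_eqF //; lia.
(* This value, proportional to A_d, is both the constant coefficient of the sextic and the leading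
   one of the trace cubic. *)
have P0_lead : zeta_target (R := R) q d (weight_count C) 0 != 0.
  rewrite target0 // mulf_neq0 ?invr_eq0 // pnatr_eq0.
  exact: weight_count_distance_neq0.
rewrite cubic_trace_cubic // all_roots_inZ //.
rewrite -palindromic_sextic_rootsP //.
(* The Riemann hypothesis supplies some zeta polynomial [P]; uniqueness identifies it with [P0]. *)
split=> [[P [[P_zeta _] rootsP]]|rootsP]; last by exists P0.
by rewrite -(P0_zeta.2 _ P_zeta) in rootsP.
Qed.
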